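(* Let $G$ be a chordal$^*$ graph on $n$ vertices and let $G^c$ be the complementary graph of $G$. Then $$\kappa(G) + \tau_{\max}(G^c) \le n-1$$ and $$0 \leq \kappa(G) \leq (n - 1) - \lceil 2\sqrt{n}-2\,\rceil.$$ Furthermore, for every integer $\kappa$ with $0 \leq \kappa \leq (n - 1) - \lceil 2\sqrt{n}-2\,\rceil$, there exists a chordal$^*$ graph $G$ on $n$ vertices satisfying $\kappa(G) = \kappa$.
   Context: All graphs are finite and simple (no loops, no multiple edges). A graph is chordal if every cycle of length at least $4$ has a chord. A vertex $x$ of $G$ is universal if $x$ is adjacent to every other vertex of $G$. A chordal$^*$ graph is a chordal graph with no universal vertex. The complementary graph $G^c$ has the same vertex set as $G$, with $\{x,y\}$ ($x\neq y$) an edge of $G^c$ iff it is not an edge of $G$. The vertex connectivity $\kappa(G)$ is the minimum cardinality of a subset $W \subset V(G)$ such that the induced subgraph of $G$ on $V(G)\setminus W$ is disconnected (so $\kappa(G)=0$ if $G$ is disconnected). A vertex cover of a graph $H$ is a subset $C\subset V(H)$ meeting every edge of $H$; $\tau_{\max}(H)$ denotes the maximum cardinality of a minimal (with respect to inclusion) vertex cover of $H$. *)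

(* Defs.v *)
From mathcomp Require Import all_boot.
Set Implicit Arguments.
Unset Strict Implicit.
Unset Printing Implicit Defensive.

Record sgraph := SGraph {
  vertex :> finType;
  adj : rel vertex;
  adj_sym : symmetric adj;
  adj_irrefl : irreflexive adj
}.

Section Complement.
Variable G : sgraph.

Definition compl_adj : rel G := [rel x y | (x != y) && ~~ adj x y].

Lemma compl_adj_sym : symmetric compl_adj.
Proof. by move=> x y; rewrite /compl_adj /= eq_sym adj_sym. Qed.

Lemma compl_adj_irrefl : irreflexive compl_adj.
Proof. by move=> x; rewrite /compl_adj /= eqxx. Qed.

Definition complement : sgraph := SGraph compl_adj_sym compl_adj_irrefl.

End Complement.

Section Induced.
Variables (G : sgraph) (S : {set G}).

Definition induced_adj : rel {x : G | x \in S} :=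
  [rel x y | adj (val x) (val y)].

Lemma induced_adj_sym : symmetric induced_adj.
Proof. by move=> x y; rewrite /induced_adj /= adj_sym. Qed.

Lemma induced_adj_irrefl : irreflexive induced_adj.
Proof. by move=> x; rewrite /induced_adj /= adj_irrefl. Qed.

Definition induced : sgraph := SGraph induced_adj_sym induced_adj_irrefl.

End Induced.

(* A chord is an edge between two vertices that are not consecutive on c. *)
Definition is_chord (G : sgraph) (c : seq G) (x y : G) : bool :=
  [&& x \in c, y \in c, adj x y, y != next c x & x != next c y].

Definition chordal (G : sgraph) : Prop :=
  forall c : seq G, ucycle (@adj G) c -> 4 <= size c ->
    exists x y : G, is_chord c x y.

(* Vacuously true of the vertex of a one-vertex graph. *)
Definition universal (G : sgraph) (x : G) : bool :=
  [forall y : G, (y != x) ==> adj x y].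

Definition chordal_star (G : sgraph) : Prop :=
  chordal G /\ forall x : G, ~~ universal x.

(* The graph with no vertex is not disconnected. *)
Definition disconnected (G : sgraph) : bool :=
  [exists x : G, exists y : G, ~~ connect (@adj G) x y].

(* Every separating set W satisfies #|W| <= #|G| - 2, so the default value
   #|G|.-1 is taken only if there is none, i.e. only if G is complete. *)
Definition kappa (G : sgraph) : nat :=
  \big[minn/#|G|.-1]_(W : {set G} | disconnected (induced (~: W))) #|W|.

Definition vertex_cover (G : sgraph) (C : {set G}) : bool :=
  [forall x : G, forall y : G, adj x y ==> (x \in C) || (y \in C)].

Definition tau_max (G : sgraph) : nat :=
  \max_(C : {set G} | minset (@vertex_cover G) C) #|C|.

(* Main.v *)
(** Minimal vertex covers of the complement of [G] are the complements of the
    maximal cliques of [G], so the first inequality says that [kappa G < #|K|]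
    for every maximal clique [K].  Choose [v] outside [K] with as many
    neighbours in [K] as possible.  These neighbours separate [v] from the rest
    of [K]: on a path avoiding [K] that leads from [v] to a neighbour of some
    other [x] in [K], the first vertex adjacent to [x] is, by chordality, also
    adjacent to all [K]-neighbours of [v], so it has more neighbours in [K].

    The second inequality follows from the first because
    [4 n <= (tau_max H + 2) ^ 2] for every graph [H] with [n] vertices, none of
    them isolated.  Indeed [H] is partitioned into [g] stars with at least two
    vertices each (a theorem of Bollobas and Cockayne on private neighbours);
    if the largest star has [m] vertices, then [n <= g m], and a minimal vertex
    cover avoiding its centre has at least [(m - 1) + (g - 1)] elements.

    The values of [kappa] are realised by split graphs: a clique [L] is mapped
    onto an independent set [C], and [l] is joined to every [c] except its
    image; the connectivity is [#|L|] minus the size of the largest fibre. *)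

Require Import Defs.
From mathcomp Require Import all_boot all_order all_algebra reals zify.
Set Implicit Arguments.
Unset Strict Implicit.
Unset Printing Implicit Defensive.

Section Sequences.
Variable T : eqType.
Implicit Types (x y : T) (s t : seq T).

Lemma next_cat_cons s y t x :
  x \in s -> next (s ++ y :: t) x = next (rcons s y) x.
Proof.
rewrite -cat_rcons => xs.
have xsy : x \in rcons s y by rewrite mem_rcons inE xs orbT.
rewrite !next_nth mem_cat xsy index_cat xsy; case: s xs xsy => // z s xs _.
rewrite rcons_cons cat_cons nth_cat -rcons_cons -cats1 index_cat xs.
by rewrite size_rcons -[(size s).+1]/(size (z :: s)) index_mem xs.
Qed.

Lemma next_last x s : uniq (x :: s) -> next (x :: s) (last x s) = x.
Proof. by move=> U; rewrite next_nth mem_last index_last // nth_default. Qed.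

Lemma path_until (e : rel T) (a : pred T) v p : path e v p -> a (last v p) ->
  exists q, [/\ path e v q, {subset v :: q <= v :: p}, a (last v q)
                & {in v :: q, forall z, a z -> z = last v q}].
Proof.
elim: p v => [|u p IH] v /= => [_ av|/andP[vu up] a_last].
  by exists [::]; split=> // z; rewrite inE => /eqP.
have [av|/negPf nav] := boolP (a v).
  exists [::]; split=> // z; rewrite inE => /eqP-> //; exact: mem_head.
have [q [uq sub aq lastq]] := IH u up a_last; exists (u :: q); split=> //=.
- by rewrite vu.
- by move=> z; rewrite !(in_cons v) => /orP[-> //|/sub ->]; rewrite orbT.
- by move=> z; rewrite inE => /orP[/eqP->|/lastq //]; rewrite nav.
Qed.

End Sequences.

Section Chords.
Variable G : sgraph.
Implicit Types (x y u v z : G) (c p : seq G).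

Lemma adj_neq x y : adj x y -> x != y.
Proof. by apply: contraTneq => ->; rewrite adj_irrefl. Qed.

Lemma is_chord_sym c x y : is_chord c x y = is_chord c y x.
Proof. by rewrite /is_chord adj_sym andbCA [(_ != _) && _]andbC. Qed.

(* A chord cuts a cycle into two cycles, one of which contains the edge from
   [x] to its successor. *)
Lemma ucycle_chord c u v x : ucycle (@adj G) c -> is_chord c u v -> x \in c ->
  exists c', [/\ ucycle (@adj G) c', 2 < size c' < size c, {subset c' <= c},
                 x \in c' & next c' x = next c x].
Proof.
case/andP=> cyc Uc; wlog x_arc : u v / x \in arc c u v.
  move=> wlog_arc uv xc; have /and5P[uc vc auv _ _] := uv.
  have [i p1 p2 arc_uv arc_vu rot_c] := rot_to_arc Uc uc vc (adj_neq auv).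
  move: (xc); rewrite -(mem_rot i) rot_c -cat_cons mem_cat arc_uv arc_vu.
  by case/orP=> /wlog_arc; apply; rewrite // is_chord_sym.
case/and5P=> uc vc auv v_next u_next xc.
have [i p1 p2 arc_uv _ rot_c] := rot_to_arc Uc uc vc (adj_neq auv).
have rot_c' : rot i c = rcons (u :: p1) v ++ p2 by rewrite rot_c -cat_rcons.
have p1_gt0 : 0 < size p1.
  rewrite lt0n; apply: contraNneq v_next => /size0nil p1_nil.
  by rewrite -(next_rot i) // rot_c p1_nil /= eqxx.
have p2_gt0 : 0 < size p2.
  rewrite lt0n; apply: contraNneq u_next => /size0nil p2_nil.
  move: rot_c'; rewrite p2_nil cats0 => rot_c'.
  by rewrite -(next_rot i) // rot_c' -{2}(last_rcons u p1 v) next_last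
    -?rcons_cons -?rot_c' ?rot_uniq.
exists (rcons (u :: p1) v); split.
- move: cyc Uc; rewrite -(rot_cycle i) -(rot_uniq i) rot_c' cat_uniq.
  rewrite /ucycle /= rcons_cat cat_path !rcons_path last_rcons (adj_sym v) auv.
  by case/andP=> -> _ /and3P[].
- rewrite -(size_rot i c) rot_c' size_cat size_rcons /= ltnS.
  by rewrite !ltnS p1_gt0 -[X in X < _]addn0 ltn_add2l.
- by move=> z zc'; rewrite -(mem_rot i) rot_c' mem_cat zc'.
- by rewrite mem_rcons inE arc_uv x_arc orbT.
- by rewrite -(next_rot i Uc) rot_c -cat_cons next_cat_cons // arc_uv.
Qed.

Lemma chordal_triangle c x : chordal G -> ucycle (@adj G) c -> 2 < size c ->
  x \in c -> exists2 z, z \in c & adj x z && adj (next c x) z.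
Proof.
move=> chG; have [m] := ubnP (size c).
elim: m c => // m IH c lt_m cyc gt2 xc; have [gt3|le3] := ltnP 3 (size c).
  have [u [v uv]] := chG c cyc gt3.
  have [c' [cyc' /andP[gt2' lt_c] sub xc' <-]] := ucycle_chord cyc uv xc.
  have [|z zc' adj_z] := IH c' _ cyc' gt2' xc'; first exact: leq_trans lt_c _.
  by exists z => //; apply: sub.
have Uc : uniq c by case/andP: cyc.
have [i s rot_c] := rot_to xc; have : size (rot i c) = 3.
  by apply/eqP; rewrite size_rot eqn_leq le3.
rewrite -(next_rot i Uc) rot_c; case: s rot_c => [|y [|z []]] //= rot_c _.
exists z; first by rewrite -(mem_rot i) rot_c !inE eqxx !orbT.
move: cyc; rewrite -(rot_ucycle i) rot_c eqxx => /andP[/= /and4P[_ -> zx _] _].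
by rewrite adj_sym zx.
Qed.

(* The third vertex of a triangle on the edge [xy] of the cycle [x y v ... z]
   can only be [z]. *)
Lemma chordal_path_last_adj v p x y : chordal G -> path (@adj G) v p ->
  x \notin v :: p -> y \notin v :: p -> adj x y -> adj v y ->
  adj x (last v p) -> {in v :: p, forall z, adj x z -> z = last v p} ->
  adj (last v p) y.
Proof.
move=> chG; case/shortenP=> q vq Uq sub x_p y_p xy vy x_last only_last.
have {}sub : {subset v :: q <= v :: p}.
  by move=> z; rewrite !inE => /orP[-> //|/sub ->]; rewrite orbT.
have cyc : ucycle (@adj G) [:: x, y & v :: q].
  rewrite /ucycle /= rcons_path xy (adj_sym y) vy vq adj_sym x_last /= inE.
  by rewrite negb_or (adj_neq xy) (contra (@sub x)) // (contra (@sub y)).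
have [||z] := @chordal_triangle _ x chG cyc; rewrite ?mem_head //= eqxx.
rewrite (in_cons x) (in_cons y) => /or3P[/eqP->|/eqP->|zq].
- by rewrite adj_irrefl.
- by rewrite adj_irrefl andbF.
- by case/andP=> xz yz; rewrite -(only_last z) ?(sub z) // adj_sym.
Qed.

Lemma chordal_path_common_neighbor v p x : chordal G -> path (@adj G) v p ->
  x \notin v :: p -> adj x (last v p) ->
  exists2 z, z \in v :: p & adj x z /\
    forall y, y \notin v :: p -> adj x y -> adj v y -> adj z y.
Proof.
move=> chG vp x_p x_last.
have [q [vq sub x_lastq only_last]] := path_until vp x_last.
exists (last v q); first by apply/sub/mem_last.
split=> // y y_p xy vy; apply: (chordal_path_last_adj (x := x)) => //.
- exact: contra (@sub x) x_p.
- exact: contra (@sub y) y_p.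
Qed.

Lemma iter_next_neq c x k : uniq c -> x \in c -> 0 < k -> k < size c ->
  iter k (next c) x != x.
Proof.
move=> Uc xc k_gt0 lt_k; apply: contraTneq k_gt0 => iter_k.
rewrite -(order_cycle (cycle_next Uc) Uc xc) in lt_k.
by rewrite -(findex_iter lt_k) iter_k findex0.
Qed.

Lemma is_chord_next_next c x : uniq c -> 3 < size c -> x \in c ->
  adj x (next c (next c x)) -> is_chord c x (next c (next c x)).
Proof.
move=> Uc gt3 xc adj_x; rewrite /is_chord !mem_next xc adj_x /=.
have /= -> := @iter_next_neq c (next c x) 1 Uc; rewrite ?mem_next //=.
  by rewrite eq_sym (@iter_next_neq c x 3).
by rewrite ltnW // ltnW.
Qed.

End Chords.

Section Connectivity.
Variable G : sgraph.
Implicit Types (x y u v w z : G) (A K S W : {set G}).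

Lemma kappa_le_separator W : disconnected (induced (~: W)) -> kappa G <= #|W|.
Proof.
exact: (@Order.TotalTheory.bigmin_le_cond _ nat _ _ W
  (fun W => disconnected (induced (~: W))) (fun W : {set G} => #|W|)).
Qed.

Lemma leq_kappa m : m <= #|G|.-1 ->
  (forall W, disconnected (induced (~: W)) -> m <= #|W|) -> m <= kappa G.
Proof. exact: (@Order.POrderTheory.le_bigmin _ nat). Qed.

Lemma disconnected_induced_closed S A x y : x \in S -> y \in S -> x \in A ->
  y \notin A -> {in S &, forall u w, adj u w -> u \in A -> w \in A} ->
  disconnected (induced S).
Proof.
move=> xS yS xA yA closedA.
apply/existsP; exists (Sub x xS); apply/existsP; exists (Sub y yS).
have /closed_connect closed_pre :
    closed (@adj (induced S)) [pred u | val u \in A].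
  apply: intro_closed => [|u w uw]; last by apply: closedA => //; apply: valP.
  exact/sym_connect_sym/adj_sym.
by apply: contra yA => /closed_pre; rewrite !inE /= xA => <-.
Qed.

Lemma connect_induced_path S (x y : induced S) :
  connect (@adj (induced S)) x y -> exists p,
  [/\ path (@adj G) (val x) p, {in val x :: p, forall z, z \in S}
    & last (val x) p = val y].
Proof.
case/connectP=> p xp ->; exists (map val p); split; last exact: last_map.
- by rewrite path_map.
- by move=> _ /(@mapP _ _ _ (x :: p))[z _ ->]; apply: valP.
Qed.

Definition clique K := [forall x in K, forall y in K, (x != y) ==> adj x y].

Lemma cliqueP K :
  reflect {in K &, forall x y, x != y -> adj x y} (clique K).
Proof.
apply: (iffP forall_inP) => [cK x y /cK/forall_inP/[apply]/implyP //|cK x xK].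
by apply/forall_inP => y yK; apply/implyP; apply: cK.
Qed.

Lemma maxset_clique_nonadj K x : maxset clique K -> x \notin K ->
  exists2 y, y \in K & ~~ adj x y.
Proof.
case/maxsetP=> /cliqueP cK mK xK.
apply/exists_inP; rewrite -negb_forall_in; apply: contra xK => /forall_inP xadj.
rewrite -(mK (x |: K)) ?setU11 ?subsetUr //.
apply/cliqueP => a b /setU1P[->|aK] /setU1P[->|bK]; rewrite ?eqxx //.
- by rewrite xadj.
- by rewrite adj_sym xadj.
- exact: cK.
Qed.

Definition dominating A :=
  [forall x, (x \notin A) ==> [exists y in A, adj x y]].

Lemma dominatingP A :
  reflect (forall x, x \notin A -> exists2 y, y \in A & adj x y) (dominating A).
Proof.
apply: (iffP forallP) => domA x; last by apply/implyP => /domA/exists_inP.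
by move=> xA; apply/exists_inP; apply: (implyP (domA x)).
Qed.

Lemma dominating_clique_connected K : clique K -> dominating K ->
  ~~ disconnected G.
Proof.
move=> /cliqueP cK /dominatingP domK.
have to_K x : exists2 y, y \in K & connect (@adj G) x y.
  have [xK|/domK[y yK xy]] := boolP (x \in K); first by exists x.
  by exists y => //; apply: connect1.
apply/existsPn=> x; apply/existsPn=> y; rewrite negbK.
have [a aK xa] := to_K x; have [b bK yb] := to_K y.
apply: connect_trans xa _; have /sym_connect_sym-> := @adj_sym G.
apply: connect_trans yb _.
by have [-> //|ba] := eqVneq b a; apply/connect1/cK.
Qed.

Definition neighbors_in K v := [set y in K | adj v y].

Lemma chordal_neighbors_in_proper K v p x : chordal G -> clique K ->
  path (@adj G) v p -> {in v :: p, forall u, u \notin K} ->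
  x \in K -> ~~ adj v x -> adj x (last v p) ->
  exists2 z, z \notin K & neighbors_in K v \proper neighbors_in K z.
Proof.
move=> chG /cliqueP cK vp p_K xK nvx x_last.
have K_p y : y \in K -> y \notin v :: p by apply: contraL => /p_K.
have [z zp [xz z_adj]] := chordal_path_common_neighbor chG vp (K_p x xK) x_last.
exists z; first exact: p_K.
apply/properP; split; last first.
  by exists x; rewrite inE xK // adj_sym.
apply/subsetP => y; rewrite !inE => /andP[yK vy]; rewrite yK.
rewrite z_adj ?K_p // cK //.
by apply: contraNneq nvx => ->.
Qed.

Lemma kappa_lt_maxset_clique K : chordal G -> maxset clique K ->
  K != setT -> kappa G < #|K|.
Proof.
move=> chG mK; rewrite -subTset => /subsetPn[v0 _ v0K].
case: (@arg_maxnP _ v0 [predC K] (fun v => #|neighbors_in K v|) v0K).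
move=> v vK vmax.
have [x xK nvx] := maxset_clique_nonadj mK vK; set W := neighbors_in K v.
have W_K : W \proper K.
  apply/properP; split; last by exists x; rewrite // inE xK.
  by apply/subsetP => y; rewrite inE => /andP[].
apply: leq_ltn_trans (kappa_le_separator _) (proper_card W_K).
have vC : v \in ~: K by rewrite inE.
pose A := [set val u | u in connect (@adj (induced (~: K))) (Sub v vC)].
apply: (@disconnected_induced_closed _ A v x); first by rewrite !inE (negPf vK).
- by rewrite !inE xK.
- exact: (imset_f val (connect0 _ (Sub v vC))).
- by apply: contraL xK => /imsetP[u _ ->]; have := valP u; rewrite inE.
move=> _ w _ wW /[swap] /imsetP[u uA ->] uw.
have [wK|wK] := boolP (w \in K); last first.
  have wC : w \in ~: K by rewrite inE.
  apply/imsetP; exists (Sub w wC) => //.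
  by apply: connect_trans uA (connect1 _).
have [p [vp p_K last_p]] := connect_induced_path uA.
rewrite -last_p adj_sym in uw.
have /maxsetp cK := mK; move: wW; rewrite !inE wK /= => nvw.
have [|z zK /proper_card] := chordal_neighbors_in_proper chG cK vp _ wK nvw uw.
  by move=> z /p_K; rewrite inE.
by rewrite ltnNge => /negP[]; apply: vmax.
Qed.

End Connectivity.

Section PrivateNeighbors.
Variable G : sgraph.
Implicit Types (u v w x y z : G) (D E : {set G}).

Definition private_neighbor D v y :=
  [&& y \notin D, adj y v & [forall z in D, adj y z ==> (z == v)]].

Lemma private_neighborP D v y : reflect
  [/\ y \notin D, adj y v & {in D, forall z, adj y z -> z = v}]
  (private_neighbor D v y).
Proof.
apply: (iffP and3P) => -[yD yv only_v]; split=> //.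
  by move=> z /(forall_inP only_v)/implyP only_vz /only_vz/eqP.
by apply/forall_inP => z zD; apply/implyP => /(only_v z zD)->.
Qed.

Lemma second_neighbor_in D v y : ~~ [exists y, private_neighbor D v y] ->
  y \notin D -> adj y v -> exists2 z, z \in D :\ v & adj y z.
Proof.
move=> /existsPn/(_ y) + yD yv.
rewrite /private_neighbor yD yv negb_forall_in => /exists_inP[z zD].
by rewrite negb_imply => /andP[yz zv]; exists z; rewrite // !inE zv.
Qed.

Lemma dominating_replace D E v : dominating D ->
  ~~ [exists y, private_neighbor D v y] -> D :\ v \subset E ->
  [exists y in E, adj v y] -> dominating E.
Proof.
move=> /dominatingP domD no_private /subsetP sDE /exists_inP vE.
apply/dominatingP => x xE; have [-> //|xv] := eqVneq x v.
have xD : x \notin D by apply: contra xE => xD; apply: sDE; rewrite !inE xv.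
have [y yD xy] := domD x xD.
have [y_v|yv] := eqVneq y v; last by exists y; rewrite ?sDE // !inE yv.
rewrite y_v in xy; have [z zD xz] := second_neighbor_in no_private xD xy.
by exists z; rewrite ?sDE.
Qed.

Lemma dominating_retraction D : dominating D -> exists f : G -> G,
  [/\ forall x, f x \in D, {in D, forall x, f x = x}
    & forall x, x \notin D -> adj x (f x)].
Proof.
move=> /dominatingP domD.
suff /fin_all_exists[f fP] x : exists y,
    [/\ y \in D, x \in D -> y = x & x \notin D -> adj x y].
  by exists f; split=> x; have [] := fP x.
have [xD|/domD[y yD xy]] := boolP (x \in D); first by exists x.
by exists y.
Qed.

Definition isolated_in D := [set x in D | ~~ [exists y in D, adj x y]].

Lemma isolated_in_exchange D v w z : v \in isolated_in D -> adj v w ->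
  z \in D :\ v -> adj w z -> isolated_in (w |: D :\ v) \proper isolated_in D.
Proof.
rewrite inE => /andP[vD v_isolated] vw zD wz.
apply/properP; split; last first.
  by exists v; rewrite !inE ?vD ?v_isolated // eqxx orbF (negPf (adj_neq vw)).
apply/subsetP => x; rewrite !inE => /andP[/predU1P[->|/andP[xv xD]]].
  by move/exists_inPn/(_ z); rewrite in_setU zD orbT wz => /(_ isT).
rewrite xD => /exists_inPn x_isolated; apply/exists_inPn => y yD.
have [->|yv] := eqVneq y v; last by apply: x_isolated; rewrite !inE yv yD orbT.
by rewrite adj_sym; apply: (exists_inPn v_isolated).
Qed.

Hypothesis no_isolated : forall x, exists y, adj x y.

(* Take [D] of minimal size and, subject to that, with as few isolated vertices
   as possible.  If [v] has no private neighbour, then by minimality [v] is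
   isolated in [D], and exchanging it for a neighbour makes fewer vertices
   isolated. *)
Lemma exists_dominating_private : exists2 D, dominating D &
  {in D, forall v, exists y, private_neighbor D v y}.
Proof.
pose weight D := #|D| * #|G|.+1 + #|isolated_in D|.
have domT : dominating [set: G] by apply/dominatingP => x; rewrite inE.
case: (@arg_minnP _ _ _ weight domT) => D domD minD; exists D => // v vD.
apply/existsP/contraT => no_private.
have cardD : #|D| = #|D :\ v|.+1 by rewrite (cardsD1 v D) vD.
have v_isolated : ~~ [exists y in D, adj v y].
  apply/negP => /exists_inP[y yD vy].
  have /minD : dominating (D :\ v).
    apply: dominating_replace domD no_private (subxx _) _.
    by apply/exists_inP; exists y; rewrite // !inE yD eq_sym adj_neq.
  rewrite leqNgt => /negP[]; rewrite /weight cardD.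
  by have : #|isolated_in (D :\ v)| <= #|G| := max_card _; lia.
have [w vw] := no_isolated v.
have wD : w \notin D.
  by apply: contra v_isolated => wD; apply/exists_inP; exists w.
have [z zD wz] : exists2 z, z \in D :\ v & adj w z.
  by apply: second_neighbor_in; rewrite // adj_sym.
pose E := w |: D :\ v; have /minD : dominating E.
  apply: dominating_replace domD no_private (subsetUr _ _) _.
  by apply/exists_inP; exists w; rewrite ?setU11.
have cardE : #|E| = #|D| by rewrite cardD cardsU1 !inE negb_and wD orbT.
rewrite leqNgt => /negP[]; rewrite /weight cardE ltn_add2l.
by apply: proper_card; apply: isolated_in_exchange zD wz; rewrite ?inE ?vD.
Qed.

(* A partition into stars with at least two vertices each: [D] is the set of
   centres and [f] maps a vertex to the centre of its star. *)
Definition star_partition D (f : G -> G) :=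
  [/\ forall x, f x \in D, {in D, forall u, f u = u},
      forall x, x \notin D -> adj x (f x)
    & {in D, forall u, exists2 y, y \notin D & f y = u}].

Lemma exists_star_partition : exists D f, star_partition D f.
Proof.
have [D domD privD] := exists_dominating_private.
have [f [fD f_id f_adj]] := dominating_retraction domD.
exists D, f; split=> // u /privD[y /private_neighborP[yD _ only_u]].
by exists y => //; apply: only_u => //; apply: f_adj.
Qed.

End PrivateNeighbors.

Lemma card_sum_preimset (T T' : finType) (f : T -> T') (A : {set T})
    (D : {set T'}) : {in A, forall x, f x \in D} ->
  #|A| = \sum_(u in D) #|A :&: f @^-1: [set u]|.
Proof.
move=> fD; rewrite -sum1_card (partition_big f (mem D)) //.
by apply: eq_bigr => u _; rewrite -sum1_card; apply: eq_bigl => x; rewrite !inE.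
Qed.

Section VertexCovers.
Variable G : sgraph.
Implicit Types (u v x y : G) (C D : {set G}).

Lemma vertex_coverP C :
  reflect (forall x y, adj x y -> (x \in C) || (y \in C)) (vertex_cover C).
Proof.
apply: (iffP forallP) => [covC x y|covC x].
  by apply/implyP; apply: (forallP (covC x)).
by apply/forallP => y; apply/implyP; apply: covC.
Qed.

Lemma leq_tau_max C : minset (@vertex_cover G) C -> #|C| <= tau_max G.
Proof. exact: (@leq_bigmax_cond _ _ (fun C : {set G} => #|C|)). Qed.

Lemma tau_max_attained :
  exists2 C : {set G}, minset (@vertex_cover G) C & tau_max G = #|C|.
Proof.
have [|C0 minC0 _] := @minset_exists _ (@vertex_cover G) setT.
  by apply/vertex_coverP => x y; rewrite inE.
have [|C minC maxC] :=
  @eq_bigmax_cond _ (minset (@vertex_cover G)) (fun C => #|C|).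
  by apply/card_gt0P; exists C0.
by exists C; last exact: maxC.
Qed.

Lemma vertex_cover_star_gt0 D f C u : star_partition D f -> vertex_cover C ->
  u \in D -> 0 < #|C :&: f @^-1: [set u]|.
Proof.
case=> _ f_id f_adj f_leaf /vertex_coverP covC uD.
have [y yD fy] := f_leaf u uD; have yu : adj y u by rewrite -fy f_adj.
apply/card_gt0P; case/orP: (covC y u yu) => [yC|uC].
  by exists y; rewrite !inE yC fy eqxx.
by exists u; rewrite !inE uC f_id // eqxx.
Qed.

(* [C] contains all leaves of [v] and a vertex of every other star. *)
Lemma card_vertex_cover_stars D f C v : star_partition D f -> vertex_cover C ->
  v \in D -> v \notin C -> #|D| + #|f @^-1: [set v]| <= #|C| + 2.
Proof.
move=> partDf covC vD vC; have [fD f_id f_adj _] := partDf.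
pose star u := f @^-1: [set u].
have /subset_leq_card leaves_le : star v :\ v \subset C :&: star v.
  apply/subsetP => x; rewrite !inE => /andP[xv /eqP fx]; rewrite fx eqxx andbT.
  have xD : x \notin D by apply: contraNN xv => /f_id <-; rewrite fx.
  have xv_adj : adj x v by rewrite -fx f_adj.
  by have /vertex_coverP/(_ _ _ xv_adj) := covC; rewrite (negPf vC) orbF.
have centres_le : #|D :\ v| <= \sum_(u in D | u != v) #|C :&: star u|.
  rewrite -sum1_card (eq_bigl (fun u => (u \in D) && (u != v))); last first.
    by move=> u; rewrite !inE andbC.
  by apply: leq_sum => u /andP[uD _]; apply: vertex_cover_star_gt0 partDf _ _.
rewrite (@card_sum_preimset _ _ f C D) // (bigD1 v) //= -!/(star _).
rewrite (cardsD1 v D) (cardsD1 v (star v)) vD inE f_id // inE eqxx.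
by move: leaves_le centres_le; rewrite /star; lia.
Qed.

Lemma tau_max_sqr_ge : (forall x, exists y, adj x y) ->
  4 * #|G| <= (tau_max G + 2) ^ 2.
Proof.
move=> no_isolated; have [-> //|/card_gt0P[x0 _]] := posnP #|G|.
have [D [f partDf]] := exists_star_partition no_isolated.
have [fD _ _ _] := partDf; pose star u := f @^-1: [set u].
case: (@arg_maxnP _ (f x0) (fun u => u \in D) (fun u => #|star u|) (fD x0)).
move=> v vD vmax.
have [|C minC C_v] := @minset_exists _ (@vertex_cover G) [set~ v].
  apply/vertex_coverP => x y xy; rewrite !inE -negb_and.
  by apply: contraTN xy => /andP[/eqP-> /eqP->]; rewrite adj_irrefl.
have vC : v \notin C by apply/negP => /(subsetP C_v); rewrite !inE eqxx.
have card_G : #|G| <= #|D| * #|star v|.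
  rewrite -cardsT (@card_sum_preimset _ _ f _ D) // -sum_nat_const.
  by apply: leq_sum => u uD; rewrite setTI; apply: vmax.
have card_C := card_vertex_cover_stars partDf (minsetp minC) vD vC.
apply: leq_trans (leq_mul (leqnn 4) card_G) _.
apply: leq_trans (nat_AGM2 _ _) _; rewrite leq_exp2r //.
by apply: leq_trans card_C _; rewrite leq_add2r leq_tau_max.
Qed.

End VertexCovers.

Section ComplementCovers.
Variable G : sgraph.
Implicit Types (x y : G) (C : {set G}).

Lemma minset_vertex_cover_complement C :
  minset (@vertex_cover (complement G)) C = maxset (@clique G) (~: C).
Proof.
rewrite maxminset setCK; apply: minset_eq => D /=.
apply/(@vertex_coverP (complement G))/cliqueP => [covD x y|cD x y /andP[xy]].
  rewrite !inE => xD yD xy; have := covD x y.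
  rewrite /= /compl_adj /= xy (negPf xD) (negPf yD).
  by case: (adj x y) => // /(_ isT).
by apply: contraNT; rewrite negb_or => /andP[xD yD]; rewrite cD ?inE.
Qed.

Lemma kappa_add_tau_max_lt : 0 < #|G| -> chordal_star G ->
  kappa G + tau_max (complement G) < #|G|.
Proof.
move=> /card_gt0P[x _] [chG no_universal].
have [C minC ->] := @tau_max_attained (complement G).
rewrite minset_vertex_cover_complement in minC.
rewrite -(cardsC (C : {set G})) addnC ltn_add2l.
apply: kappa_lt_maxset_clique => //; have /maxsetp/cliqueP cK := minC.
apply: contraNneq (no_universal x) => K_T.
by apply/forallP => y; apply/implyP => yx; rewrite cK ?K_T ?inE // eq_sym.
Qed.

Lemma complement_no_isolated : (forall x, ~~ universal x) ->
  forall x : complement G, exists y, adj x y.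
Proof.
move=> no_universal x; have /forallPn[y] := no_universal x.
rewrite negb_imply => /andP[yx nxy]; exists y.
by rewrite /= /compl_adj /= eq_sym yx.
Qed.

End ComplementCovers.

Lemma split_chordal (G : sgraph) (K : {set G}) :
  clique K -> {in ~: K &, forall x y, ~~ adj x y} -> chordal G.
Proof.
move=> /cliqueP cK indep c /andP[cyc Uc] gt3.
have adj_K x y : adj x y -> (x \in K) || (y \in K).
  by apply: contraTT; rewrite negb_or => /andP[xK yK]; rewrite indep ?inE.
suff [x xc /andP[xK nnxK]] :
    exists2 x, x \in c & (x \in K) && (next c (next c x) \in K).
  exists x, (next c (next c x)); apply: is_chord_next_next => //.
  by apply: cK => //; rewrite eq_sym (@iter_next_neq _ c x 2) // ltnW.
have [/allP c_K|/allPn[y yc yK]] := boolP (all (mem K) c).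
  case: c gt3 c_K {cyc Uc} => // x c _ c_K.
  exists x; first exact: mem_head.
  by apply/andP; split; apply: c_K; rewrite ?mem_next mem_head.
exists (prev c y); rewrite ?mem_prev // next_prev //.
move: (adj_K _ _ (prev_cycle cyc yc)) (adj_K _ _ (next_cycle cyc yc)).
by rewrite (negPf (yK : y \notin K)) orbF => ->.
Qed.

Section SplitGraph.
Variables (C L : finType) (f : L -> C).
Implicit Types (c : C) (l : L).

Definition split_adj : rel (C + L) := fun x y =>
  match x, y with
  | inl _, inl _ => false
  | inl c, inr l | inr l, inl c => f l != c
  | inr l, inr l' => l != l'
  end.

Lemma split_adj_sym : symmetric split_adj.
Proof. by case=> [c|l] [c'|l'] //=; rewrite eq_sym. Qed.

Lemma split_adj_irrefl : irreflexive split_adj.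
Proof. by case=> [c|l] //=; rewrite eqxx. Qed.

Definition split_graph : sgraph := SGraph split_adj_sym split_adj_irrefl.

Lemma split_graph_chordal_star : (forall c, exists l, f l = c) ->
  chordal_star split_graph.
Proof.
move=> f_surj; split=> [|[c|l]].
- apply: (@split_chordal _ [set x : split_graph | ~~ is_inl x]).
    by apply/cliqueP => -[?|l] [?|l']; rewrite !inE.
  by move=> [c|?] [c'|?]; rewrite !inE.
- by have [l <-] := f_surj c; apply/forallPn; exists (inr l); rewrite /= eqxx.
- by apply/forallPn; exists (inl (f l)); rewrite /= eqxx.
Qed.

Local Notation fiber c := (f @^-1: [set c]).

Lemma kappa_split_graph_le c l : f l = c ->
  kappa split_graph <= #|L| - #|fiber c|.
Proof.
move=> fl; pose W : {set split_graph} := inr @: ~: fiber c.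
have inrW l' : (inr l' \in W) = (f l' != c).
  by rewrite mem_imset ?inE //; apply: inr_inj.
have -> : #|L| - #|fiber c| = #|W|.
  by rewrite card_imset ?[RHS]cardsCs ?setCK //; apply: inr_inj.
apply: kappa_le_separator.
apply: (@disconnected_induced_closed split_graph _ [set inl c] (inl c) (inr l)).
- by rewrite inE; apply/imsetP => -[].
- by rewrite inE inrW fl eqxx.
- by rewrite inE.
- by rewrite inE.
- move=> x [c'|l'] _; rewrite !inE => + + /eqP x_c; rewrite x_c //=.
  by rewrite inrW => /negPf->.
Qed.

Lemma split_graph_induced_connected (W : {set split_graph}) :
  (forall c, #|W| + #|fiber c| < #|L|) -> ~~ disconnected (induced (~: W)).
Proof.
move=> ltL; pose K := [set x : induced (~: W) | ~~ is_inl (val x)].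
apply: (@dominating_clique_connected _ K).
  by apply/cliqueP => -[[?|l] lW] [[?|l'] l'W]; rewrite !inE.
apply/dominatingP => -[[c|l] cW]; rewrite !inE // => _.
pose WL : {set L} := inr @^-1: W.
have le_WL : #|WL| <= #|W|.
  rewrite -(card_imset (mem WL) (@inr_inj C L)); apply: subset_leq_card.
  by apply/subsetP => _ /imsetP[l lW ->]; rewrite inE in lW.
have /subsetPn[l _] : ~~ (setT \subset WL :|: fiber c).
  apply: contraL (ltL c) => /subset_leq_card; rewrite cardsT -leqNgt => le_L.
  by apply: leq_trans le_L (leq_trans (leq_card_setU _ _) _); rewrite leq_add2r.
rewrite !inE negb_or => /andP[lW flc].
have lW' : (inr l : split_graph) \in ~: W by rewrite inE.
by exists (Sub (inr l) lW'); rewrite ?inE.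
Qed.

Lemma kappa_split_graph : 0 < #|L| ->
  kappa split_graph = #|L| - \max_c #|fiber c|.
Proof.
case/card_gt0P=> l _; have C_gt0 : 0 < #|C| by apply/card_gt0P; exists (f l).
have [c max_c] := eq_bigmax (fun c => #|fiber c|) C_gt0.
have fiber_le c' : #|fiber c'| <= #|fiber c| by rewrite -max_c leq_bigmax.
have /card_gt0P[l'] : 0 < #|fiber c|.
  by apply: leq_trans (fiber_le (f l)); apply/card_gt0P; exists l; rewrite !inE.
rewrite !inE => /eqP fl'; rewrite [X in _ - X]max_c.
apply/eqP; rewrite eqn_leq (kappa_split_graph_le fl') /=.
apply: leq_kappa => [|W].
  by rewrite card_sum -(prednK C_gt0) (leq_trans (leq_subr _ _)) // leq_addl.
apply: contraTT; rewrite -ltnNge => lt_L.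
apply: split_graph_induced_connected => c'.
by rewrite addnC -ltn_subRL (leq_trans lt_L) // leq_sub2l.
Qed.

End SplitGraph.

Lemma card_preimset_tag (I : finType) (T_ : I -> finType) (i : I) :
  #|(@tag I T_) @^-1: [set i]| = #|T_ i|.
Proof.
rewrite -!sum1_card -(big_pred1_eq addn i (fun i => \sum_(j in T_ i) 1)).
by rewrite sig_big_dep; apply: eq_bigl => p; rewrite !inE andbT.
Qed.

Lemma sum_divnD g k : 0 < g -> \sum_(i < g) (k + i) %/ g = k.
Proof.
case: g => // g _; elim: k => [|k IH].
  by rewrite big1 // => i _; rewrite divn_small ?ltn_ord.
move: IH; rewrite big_ord_recl big_ord_recr /= addn0.
rewrite addSnnS divnDr // divnn addn1 addnS addnC => IH.
rewrite -[in RHS]IH; congr (_ + _).+1.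
by apply: eq_bigr => i _; rewrite addSnnS.
Qed.

Lemma exists_chordal_star_fibers (C : finType) (s : C -> nat) :
  0 < #|C| -> (forall c, 0 < s c) -> exists G : sgraph,
  [/\ #|G| = #|C| + \sum_c s c, chordal_star G
    & kappa G = \sum_c s c - \max_c s c].
Proof.
move=> /card_gt0P[c _] s_gt0.
have card_leaves : #|{: {c : C & 'I_(s c)}}| = \sum_c s c.
  rewrite card_tagged sumnE big_map big_enum.
  by apply: eq_bigr => i _; rewrite card_ord.
exists (split_graph (@tag C (fun c => 'I_(s c)))); split.
- by rewrite card_sum card_leaves.
- apply: split_graph_chordal_star => c'.
  by exists (Tagged (fun c => 'I_(s c)) (Ordinal (s_gt0 c'))).
- rewrite kappa_split_graph card_leaves; last first.
    by rewrite (bigD1 c) //= addn_gt0 s_gt0.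
  by congr (_ - _); apply: eq_bigr => i _; rewrite card_preimset_tag card_ord.
Qed.

(* One fibre has size [m]; the [g] others, of sizes [(k + j) %/ g], share [k] as
   evenly as possible. *)
Lemma exists_chordal_star_card g k m : 0 < m -> g <= k <= g * m ->
  exists G : sgraph, [/\ #|G| = g.+1 + (m + k), chordal_star G & kappa G = k].
Proof.
move=> m_gt0 /andP[le_gk le_km].
pose s (i : 'I_g.+1) := if unlift ord0 i is Some j then (k + j) %/ g else m.
have s_lift i : s (lift ord0 i) = (k + i) %/ g by rewrite /s liftK.
have s0 : s ord0 = m by rewrite /s unlift_none.
have lift_bounds (i : 'I_g) : 0 < (k + i) %/ g <= m.
  have g_gt0 : 0 < g := leq_ltn_trans (leq0n i) (ltn_ord i).
  rewrite divn_gt0 // (leq_trans le_gk) ?leq_addr // -ltnS ltn_divLR //=.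
  by rewrite mulSnr mulnC -addnS leq_add.
have [||G [card_G chG kappa_G]] := exists_chordal_star_fibers (s := s).
- by rewrite card_ord.
- move=> i; case: (unliftP ord0 i) => [j ->|->]; last by rewrite s0.
  by rewrite s_lift; case/andP: (lift_bounds j).
have sum_s : \sum_i s i = m + k.
  rewrite big_ord_recl s0 (eq_bigr _ (fun i _ => s_lift i)); congr (_ + _).
  case: g le_gk le_km {s s_lift s0 lift_bounds G card_G chG kappa_G} => [|g] *.
    by rewrite big_ord0; lia.
  exact: sum_divnD.
have max_s : \max_i s i = m.
  rewrite big_ord_recl s0 (eq_bigr _ (fun i _ => s_lift i)); apply/maxn_idPl.
  by apply/bigmax_leqP => i _; case/andP: (lift_bounds i).
by exists G; split; rewrite // ?card_G ?kappa_G sum_s ?card_ord // max_s addKn.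
Qed.

Lemma leq_mul_minn_half k t : 4 * k <= t ^ 2 ->
  k <= minn k (t %/ 2) * (t - minn k (t %/ 2)).
Proof.
move=> sqr_ge; have : t = t %/ 2 + t %/ 2 \/ t = t %/ 2 + (t %/ 2).+1 by lia.
case: (leqP k (t %/ 2)) => [le_k _|_]; first by nia.
by move: (t %/ 2) => h [t_eq|t_eq]; move: sqr_ge; rewrite t_eq addKn; nia.
Qed.

Lemma exists_chordal_star_kappa k t : 0 < t -> 4 * k <= t ^ 2 ->
  exists G : sgraph, [/\ #|G| = k + t + 1, chordal_star G & kappa G = k].
Proof.
move=> t_gt0 sqr_ge; pose g := minn k (t %/ 2).
have le_gk : g <= k := geq_minl _ _.
have lt_gt : g < t by rewrite /g; lia.
have le_kg : k <= g * (t - g) := leq_mul_minn_half sqr_ge.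
have [||G [card_G chG kappa_G]] := @exists_chordal_star_card g k (t - g).
- by rewrite subn_gt0.
- by rewrite le_gk.
- by exists G; split=> //; rewrite card_G; lia.
Qed.

Import Order.TTheory GRing.Theory Num.Theory.
Local Open Scope ring_scope.

Lemma ceil_2sqrtB2_le (R : realType) (n t : nat) :
  (Num.ceil (2 * Num.sqrt (n%:R : R) - 2) <= t%:Z) = (4 * n <= (t + 2) ^ 2)%N.
Proof.
rewrite ceil_le_int lerBlDr -[2 in X in _ <= X]/(2%:R) -[t%:~R]/(t%:R) -natrD.
rewrite -(@ler_pXn2r _ 2) ?nnegrE ?mulr_ge0 ?ler0n ?sqrtr_ge0 //.
by rewrite exprMn sqr_sqrtr ?ler0n // -!natrX -natrM ler_nat.
Qed.

Lemma ceil_2sqrtB2_ge0 (R : realType) (n : nat) : (0 < n)%N ->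
  0 <= Num.ceil (2 * Num.sqrt (n%:R : R) - 2).
Proof.
move=> n_gt0; rewrite -(ler_int R) (le_trans _ (ceil_ge _)) // subr_ge0.
by rewrite ler_peMr // -[X in X <= _]sqrtr1 ler_wsqrtr ?ler1n.
Qed.

Theorem theorem1p1 (R : realType) (n : nat) (n_gt0 : (0 < n)%N) :
  (forall G : sgraph, #|G| = n -> chordal_star G ->
     (kappa G)%:Z + (tau_max (complement G))%:Z <= n%:Z - 1 /\
     0 <= (kappa G)%:Z
       <= (n%:Z - 1) - Num.ceil (2 * Num.sqrt (n%:R : R) - 2)) /\
  ((1 < n)%N ->
   forall k : int,
     0 <= k <= (n%:Z - 1) - Num.ceil (2 * Num.sqrt (n%:R : R) - 2) ->
     exists G : sgraph, [/\ #|G| = n, chordal_star G & (kappa G)%:Z = k]).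
Proof.
split=> [G card_G chG | n_gt1 k /andP[]].
  rewrite -card_G in n_gt0 *.
  have kappa_tau := kappa_add_tau_max_lt n_gt0 chG.
  have tau_ge : (4 * #|G| <= (tau_max (complement G) + 2) ^ 2)%N.
    exact: tau_max_sqr_ge (complement_no_isolated chG.2).
  by rewrite -(ceil_2sqrtB2_le R) in tau_ge; lia.
case: k => // k _ le_k; have ceil_ge0 := ceil_2sqrtB2_ge0 R n_gt0.
have [t n_eq] : exists t, n = (k + t + 1)%N by exists (n - k - 1)%N; lia.
have : Num.ceil (2 * Num.sqrt (n%:R : R) - 2) <= t%:Z by lia.
rewrite ceil_2sqrtB2_le {}n_eq in n_gt1 * => n_le.
have [||G [card_G chG kappa_G]] := @exists_chordal_star_kappa k t.
- by nia.
- by nia.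
- by exists G; split; rewrite ?kappa_G.
Qed.
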